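(* Let $c_\beta,c_\eta>0$. There is a constant $C$ depending only on $L,\sigma,\Delta_f,c_\beta,c_\eta$ such that the following holds. Suppose Assumptions (A1), (A3), (A4) hold, $T\ge1$, and Lion (v1) is run with $\beta_2=c_\beta T^{-1/2}\le 1$, $\beta_2^2\le\beta_1\le\sqrt{\beta_2}$, $\eta=c_\eta d^{-1/2}T^{-3/4}$, $0\le\lambda\le\frac{1}{2\eta T}$ and $\|\mathbf{x}_1\|_\infty\le\eta$. Then $$\frac1T\sum_{t=1}^T\mathbb{E}\left[\|\nabla f(\mathbf{x}_t)\|_1\right]\le C\,\frac{d^{1/2}}{T^{1/4}} .$$
   Context: Setting: $f:\mathbb{R}^d\to\mathbb{R}$ is accessed through a stochastic gradient oracle: at each query a fresh sample $\xi$ is drawn from a fixed distribution, independently of everything before, and $\nabla f(\mathbf{x};\xi)$ is returned. $\|\cdot\|$ is the Euclidean norm, $\|\cdot\|_1,\|\cdot\|_\infty$ the $\ell_1$- and max-norms; $\operatorname{sign}$ acts coordinatewise with values in $\{-1,0,1\}$. (A1) $\|\nabla f(\mathbf{x})-\nabla f(\mathbf{y})\|\le L\|\mathbf{x}-\mathbf{y}\|$ for all $\mathbf{x},\mathbf{y}$. (A3) $\mathbb{E}_\xi[\nabla f(\mathbf{x};\xi)]=\nabla f(\mathbf{x})$ and $\mathbb{E}_\xi\|\nabla f(\mathbf{x};\xi)-\nabla f(\mathbf{x})\|^2\le\sigma^2$ for all $\mathbf{x}$. (A4) $f_*=\inf_{\mathbf{x}}f(\mathbf{x})>-\infty$ and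 $f(\mathbf{x}_1)-f_*\le\Delta_f$. Lion (v1): given $\mathbf{x}_1\in\mathbb{R}^d$, $\beta_1,\beta_2\in(0,1]$, $\eta>0$, $\lambda\ge0$. At $t=1$ draw $\xi_1$ and set $\mathbf{v}_1=\mathbf{m}_1=\nabla f(\mathbf{x}_1;\xi_1)$. For $t\ge2$ draw a fresh $\xi_t$ and set $\mathbf{v}_t=(1-\beta_1)\mathbf{m}_{t-1}+\beta_1\nabla f(\mathbf{x}_t;\xi_t)$, $\mathbf{m}_t=(1-\beta_2)\mathbf{m}_{t-1}+\beta_2\nabla f(\mathbf{x}_t;\xi_t)$. For all $t\ge1$: $\mathbf{x}_{t+1}=\mathbf{x}_t-\eta(\operatorname{sign}(\mathbf{v}_t)+\lambda\mathbf{x}_t)$. *)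

(* Defs.v *)
From HB Require Import structures.
From mathcomp Require Import all_boot all_order all_algebra.
From mathcomp Require Import all_classical all_reals all_analysis.
Set Implicit Arguments. Unset Strict Implicit. Unset Printing Implicit Defensive.
Import Order.TTheory GRing.Theory Num.Theory.
Import numFieldNormedType.Exports.
Local Open Scope classical_set_scope.
Local Open Scope ring_scope.

Section LionDefs.
Variable R : realType.
Variable d : nat.
Notation vec := 'rV[R]_d.

Definition norm2 (x : vec) : R := Num.sqrt (\sum_(i < d) x ord0 i ^+ 2).
Definition norm1 (x : vec) : R := \sum_(i < d) `|x ord0 i|.
Definition norminf (x : vec) : R := \big[Num.max/0]_(i < d) `|x ord0 i|.
Definition dotv (x y : vec) : R := \sum_(i < d) x ord0 i * y ord0 i.
Definition signv (x : vec) : vec := map_mx (fun a => Num.sg a) x.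

(* encoding of a vector as a d-tuple (to use the product sigma-algebra) *)
Definition row_of_tuple (t : d.-tuple R) : vec := \row_(i < d) tnth t i.

(* Lion (v1).  [lion_state G xi b1 b2 eta lam x1 n] = (x_{n+1}, m_n),
   where xi t is the sample drawn at iteration t (t >= 1) and
   G x s is the stochastic gradient at x with sample s.  (m_0 is unused.) *)
Fixpoint lion_state (S : Type) (G : vec -> S -> vec) (xi : nat -> S)
    (b1 b2 eta lam : R) (x1 : vec) (n : nat) : vec * vec :=
  match n with
  | 0 => (x1, 0)
  | n'.+1 =>
    let xm := lion_state G xi b1 b2 eta lam x1 n' in
    let x := xm.1 in let m := xm.2 in
    let g := G x (xi n'.+1) in
    let v := if n' == 0%N then g else (1 - b1) *: m + b1 *: g in
    let m' := if n' == 0%N then g else (1 - b2) *: m + b2 *: g in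
    (x - eta *: (signv v + lam *: x), m')
  end.

(* the iterate x_t of Lion (v1), for t >= 1 *)
Definition lion_x (S : Type) (G : vec -> S -> vec) (xi : nat -> S)
    (b1 b2 eta lam : R) (x1 : vec) (t : nat) : vec :=
  (lion_state G xi b1 b2 eta lam x1 t.-1).1.
End LionDefs.

Definition mutually_independent {R : realType} {dO dS : measure_display}
    {Omega : measurableType dO} {S : measurableType dS}
    (P : probability Omega R) (xi : nat -> Omega -> S) : Prop :=
  forall (s : seq nat) (A : nat -> set S),
    uniq s -> (forall t, measurable (A t)) ->
    P (\big[setI/setT]_(t <- s) (xi t @^-1` A t))
    = (\prod_(t <- s) P (xi t @^-1` A t))%E.

(* Main.v *)
(** Along a sample path the iterates satisfy |x_t|_oo <= t eta, so the decay
  term lam x_t has entries at most 1/2 and each step has entries at most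
  (3/2) eta.  Since g sign(v) >= |g| - 2 |g - v|, smoothness turns each step
  into a decrease of f by (eta/2) |grad f(x_t)|_1, up to the update error
  |v_t - grad f(x_t)|_1 and a term of order eta^2 d.  The fresh sample xi_t is
  independent of (x_t, m_(t-1)), so cross terms vanish in the second moment of
  the momentum error, which therefore contracts by 1 - b2 per step up to
  O(b2^2 sigma^2 + L^2 eta^2 d / b2); on average it is O(T^(-1/2)).  Young's
  inequality with weight sqrt(d) T^(1/4) replaces both Cauchy-Schwarz and
  Jensen when passing from squared l2-errors back to l1-errors. *)

Require Import Defs.
From HB Require Import structures.
From mathcomp Require Import all_boot all_order all_algebra.
From mathcomp Require Import all_classical all_reals all_analysis.
From mathcomp Require Import measurable_realfun.
From mathcomp Require Import ring lra.
Import Order.TTheory GRing.Theory Num.Theory.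
Import numFieldNormedType.Exports.
Local Open Scope classical_set_scope.
Local Open Scope ring_scope.

(** * Independence of the fresh sample *)

Section Freshness.
Context {R : realType} {dO dZ dS : measure_display}
  {Omega : measurableType dO} {Z : measurableType dZ} {S : measurableType dS}.
Variables (P : probability Omega R).
Local Open Scope ereal_scope.

(** Two finite measures on the product are compared: the law of the pair restricted to [E], and its
    full law scaled by [P E]. They agree on measurable rectangles, a generating family closed under
    intersection, hence everywhere. *)
Lemma pair_event_indep (X : Omega -> Z) (Y : Omega -> S) (E : set Omega) :
  measurable_fun setT X -> measurable_fun setT Y -> measurable E ->
  (forall B A, measurable B -> measurable A ->
    P (X @^-1` B `&` Y @^-1` A `&` E) = P (X @^-1` B `&` Y @^-1` A) * P E) ->
  forall C, measurable C ->
    P ((fun w => (X w, Y w)) @^-1` C `&` E)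
    = P ((fun w => (X w, Y w)) @^-1` C) * P E.
Proof.
move=> mX mY mE XYE C mC.
have mXY : measurable_fun setT (fun w => (X w, Y w)) by exact: measurable_fun_pair.
pose XY : {mfun Omega >-> (Z * S)%type} := HB.pack (fun w => (X w, Y w))
  (isMeasurableFun.Build _ _ _ _ _ mXY).
have PEfin : P E = (fine (P E))%:E by rewrite fineK// fin_num_measure.
have PE0 : (0 <= fine (P E))%R by exact/fine_ge0/measure_ge0.
pose m1 : {measure set (Z * S)%type -> \bar R} := pushforward (mrestr P mE) XY.
pose m2 : {measure set (Z * S)%type -> \bar R} :=
  mscale (NngNum PE0) (pushforward P XY).
suff : m1 mXY C = m2 mXY C.
  rewrite /m1 /m2 /= /pushforward /mrestr /mscale /= -PEfin => ->.
  by rewrite muleC.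
pose G : set (set (Z * S)%type) :=
  [set C | exists A, measurable A /\ exists B, measurable B /\ C = A `*` B].
apply: (measure_unique G (fun=> setT)) => //.
- rewrite measurable_prod_measurableType //; congr (<<s _ >>).
  rewrite predeqE; split => [[A mA [B mB <-]]|[A [mA [B [mB ->]]]]].
    by exists A; split => //; exists B.
  by exists A => //; exists B.
- move=> /= _ _ [X1 [mX1 [X2 [mX2 ->]]]] [Y1 [mY1 [Y2 [mY2 ->]]]].
  rewrite -setXI; exists (X1 `&` Y1); split; first exact: measurableI.
  by exists (X2 `&` Y2); split => //; exact: measurableI.
- by move=> _; exists setT; split=> //; exists setT; split=> //; rewrite setXTT.
- by rewrite bigcup_const//; exists 0%N.
- move=> _ [A [mA [B [mB ->]]]].
  rewrite /m1 /m2 /= /pushforward /mrestr /mscale /= -PEfin.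
  rewrite (_ : _ @^-1` _ = X @^-1` A `&` Y @^-1` B)// XYE//.
  by rewrite muleC.
- move=> _; rewrite /m1 /= /pushforward /mrestr /= preimage_setT setTI.
  by rewrite ltey_eq fin_num_measure.
Qed.

(** A recursion with a deterministic start has consumed only samples 1 to [n] when it reaches
    [Zs n]. The algorithm enters only through the measurable update [Phi]. *)
Lemma fresh_sample_indep (xi : nat -> Omega -> S) (Phi : nat -> Z * S -> Z)
    (Zs : nat -> Omega -> Z) (z0 : Z) :
  (forall t, measurable_fun setT (xi t)) -> mutually_independent P xi ->
  (forall n, measurable_fun setT (Phi n)) -> (Zs 0%N = cst z0) ->
  (forall n w, Zs n.+1 w = Phi n (Zs n w, xi n.+1 w)) ->
  forall n, measurable_fun setT (Zs n) /\
    forall B A, measurable B -> measurable A ->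
    P (Zs n @^-1` B `&` xi n.+1 @^-1` A) = P (Zs n @^-1` B) * P (xi n.+1 @^-1` A).
Proof.
move=> mxi ixi mPhi Z0 ZS.
have mxiA t A : measurable A -> measurable (xi t @^-1` A).
  by move=> mA; rewrite -[X in measurable X]setTI; exact: mxi.
have mcap (s : seq nat) (A : nat -> set S) : (forall t, measurable (A t)) ->
    measurable (\big[setI/setT]_(t <- s) (xi t @^-1` A t)).
  by move=> mA; apply: bigsetI_measurable => t _; exact: mxiA.
(* The stronger claim, joint independence from all later samples, is inductive. *)
suff H n : measurable_fun setT (Zs n) /\
    forall B (s : seq nat) (A : nat -> set S), measurable B ->
      uniq s -> all (ltn n) s -> (forall t, measurable (A t)) ->
    P (Zs n @^-1` B `&` \big[setI/setT]_(t <- s) (xi t @^-1` A t))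
    = P (Zs n @^-1` B) * P (\big[setI/setT]_(t <- s) (xi t @^-1` A t)).
  move=> n; have [mZ HZ] := H n; split=> // B A mB mA.
  have /= := HZ B [:: n.+1] (fun=> A) mB isT; rewrite !big_seq1 ltnSn.
  exact.
elim: n => [|n [mZ IH]].
  rewrite Z0; split=> // B s A mB us _ mA.
  rewrite preimage_cst; case: ifPn => _.
    by rewrite setTI probability_setT mul1e.
  by rewrite set0I measure0 mul0e.
have ZE : Zs n.+1 = Phi n \o (fun w => (Zs n w, xi n.+1 w)).
  by apply/funext => w; rewrite ZS.
split.
  rewrite ZE; apply: measurableT_comp => //; exact: measurable_fun_pair.
move=> B s A mB us sn mA.
rewrite ZE comp_preimage.
apply: (@pair_event_indep (Zs n) (xi n.+1)) => //; first exact: mcap.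
  move=> B' A' mB' mA'.
  have sn' : all (ltn n) s by apply: sub_all sn => t /=; exact: ltnW.
  have us' : n.+1 \notin s.
    by apply/negP => /(allP sn) /=; rewrite ltnn.
  (* The event on sample [n.+1] and those on [s] are glued into one family, the form in which both
     the induction hypothesis and mutual independence are stated. *)
  pose A2 t := if t == n.+1 then A' else A t.
  have mA2 t : measurable (A2 t) by rewrite /A2; case: ifP.
  have A2s (s' : seq nat) : {subset s' <= s} ->
    \big[setI/setT]_(t <- s') (xi t @^-1` A2 t)
      = \big[setI/setT]_(t <- s') (xi t @^-1` A t).
    move=> s's; apply: eq_big_seq => t /s's ts; rewrite /A2 ifN//.
    by apply: contraNneq us' => <-.
  have A2n : A2 n.+1 = A' by rewrite /A2 eqxx.
  have E1 := IH B' [:: n.+1] A2 mB' isT.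
  have E2 := IH B' (n.+1 :: s) A2 mB'.
  move: E1 E2; rewrite !big_cons !big_nil !setIT /= us' us ltnSn sn'.
  rewrite A2n A2s// => -> // E2.
  rewrite -setIA E2// -muleA; congr (_ * _).
  have := ixi (n.+1 :: s) A2; rewrite /= us' us => /(_ isT mA2).
  rewrite !big_cons (A2s s)// A2n => ->; congr (_ * _).
  rewrite ixi//; apply: eq_big_seq => t ts; rewrite /A2 ifN//.
  by apply: contraNneq us' => <-.
by rewrite -[X in measurable X]setTI; exact: mPhi.
Qed.

(** Independence makes the joint law the product of the law of [X] with [mu]; Tonelli then
    integrates the sample out while the state is frozen. *)
Lemma integral_indep_pair (mu : probability S R) (X : Omega -> Z)
    (Y : Omega -> S) (f : Z * S -> \bar R) :
  measurable_fun setT X -> measurable_fun setT Y ->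
  (forall A, measurable A -> P (Y @^-1` A) = mu A) ->
  (forall B A, measurable B -> measurable A ->
    P (X @^-1` B `&` Y @^-1` A) = P (X @^-1` B) * P (Y @^-1` A)) ->
  measurable_fun [set: Z * S] f -> (forall z, 0 <= f z) ->
  \int[P]_w f (X w, Y w) = \int[P]_w \int[mu]_s f (X w, s).
Proof.
move=> mX mY YE XY mf f0.
have mXY : measurable_fun setT (fun w => (X w, Y w)) by exact: measurable_fun_pair.
pose X' : {mfun Omega >-> Z} := HB.pack X (isMeasurableFun.Build _ _ _ _ _ mX).
pose XY' : {mfun Omega >-> (Z * S)%type} := HB.pack (fun w => (X w, Y w))
  (isMeasurableFun.Build _ _ _ _ _ mXY).
transitivity (\int[pushforward P XY']_z f z).
  by rewrite ge0_integral_pushforward// => z _; exact: f0.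
transitivity (\int[distribution P X' \x mu]_z f z).
  apply: eq_measure_integral => C mC _; apply/esym.
  apply: product_measure_unique => // A B mA mB.
  by rewrite /distribution /pushforward /= -YE//= -XY.
rewrite fubini_tonelli1// ge0_integral_distribution//.
  exact: measurable_fun_fubini_tonelli_F.
by move=> z; exact: integral_ge0.
Qed.

End Freshness.

(** * Random vectors and the stochastic oracle *)

Definition normsq {R : realType} {d : nat} (x : 'rV[R]_d) : R :=
  \sum_(i < d) x ord0 i ^+ 2.

Definition tuple_of_row {R : realType} {d : nat} (x : 'rV[R]_d) : d.-tuple R :=
  [tuple x ord0 i | i < d].

(** Through [tuple_of_row] this amounts to measurability for the product sigma-algebra on tuples. *)
Definition measurable_vec {R : realType} {d : nat} {dT : measure_display}
    {T : measurableType dT} (f : T -> 'rV[R]_d) : Prop :=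
  forall i, measurable_fun setT (fun t => f t ord0 i).

Section VectorMeasurability.
Context {R : realType} {d : nat} {dT : measure_display} {T : measurableType dT}.
Implicit Types (x : 'rV[R]_d) (f g : T -> 'rV[R]_d).

Lemma tuple_of_rowK : cancel (@tuple_of_row R d) (@row_of_tuple R d).
Proof. by move=> x; apply/rowP => i; rewrite mxE tnth_mktuple. Qed.

Lemma normsq_ge0 x : 0 <= normsq x.
Proof. by apply: sumr_ge0 => i _; exact: sqr_ge0. Qed.

Lemma norm2_sqr x : norm2 x ^+ 2 = normsq x.
Proof. by rewrite sqr_sqrtr// normsq_ge0. Qed.

Lemma norm1_ge0 x : 0 <= norm1 x.
Proof. exact: sumr_ge0. Qed.

Lemma measurable_vec_tuple f :
  measurable_vec f -> measurable_fun setT (tuple_of_row \o f).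
Proof.
move=> mf; apply/measurable_fun_tnthP => i.
apply: eq_measurable_fun (mf i) => t _ /=.
by rewrite tnth_mktuple.
Qed.

Lemma measurable_vec_row (t : T -> d.-tuple R) :
  measurable_fun setT t -> measurable_vec (fun w => row_of_tuple (t w)).
Proof.
move=> mt i; apply: eq_measurable_fun ((measurable_fun_tnthP _).1 mt i) => w _ /=.
by rewrite mxE.
Qed.

Lemma measurable_vecD f g :
  measurable_vec f -> measurable_vec g -> measurable_vec (fun w => f w + g w).
Proof.
move=> mf mg i; apply: eq_measurable_fun (measurable_funD (mf i) (mg i)) => w _.
by rewrite mxE.
Qed.

Lemma measurable_vecB f g :
  measurable_vec f -> measurable_vec g -> measurable_vec (fun w => f w - g w).
Proof.
move=> mf mg i; apply: eq_measurable_fun (measurable_funB (mf i) (mg i)) => w _.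
by rewrite !mxE.
Qed.

Lemma measurable_vecZ (a : R) f :
  measurable_vec f -> measurable_vec (fun w => a *: f w).
Proof.
move=> mf i.
apply: eq_measurable_fun (measurable_funM (measurable_cst a) (mf i)) => w _.
by rewrite !mxE.
Qed.

Lemma measurable_sgr : measurable_fun [set: R] (@Num.sg R).
Proof.
have sgE (y : R) : (0 < y)%R%:R - (y < 0)%R%:R = Num.sg y.
  by case: sgrP; rewrite ?subrr ?subr0 ?sub0r.
have -> : @Num.sg R = (fun y => (if 0 < y then 1 else 0) - (if y < 0 then 1 else 0)).
  by apply/funext => y; rewrite -sgE; do 2 case: ifP.
apply: measurable_funB; apply: measurable_fun_ifT => //;
  exact: measurable_fun_ltr.
Qed.

Lemma measurable_signv f : measurable_vec f -> measurable_vec (fun w => signv (f w)).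
Proof.
move=> mf i; apply: eq_measurable_fun (measurableT_comp measurable_sgr (mf i)) => w _ /=.
by rewrite mxE.
Qed.

Lemma measurable_normsq f : measurable_vec f -> measurable_fun setT (fun w => normsq (f w)).
Proof. by move=> mf; apply: measurable_sum => i; apply: measurable_funX; exact: mf. Qed.

Lemma measurable_norm1 f : measurable_vec f -> measurable_fun setT (fun w => norm1 (f w)).
Proof. by move=> mf; apply: measurable_sum => i; exact: measurableT_comp (mf i). Qed.

End VectorMeasurability.

Section Oracle.
Context {R : realType} {d : nat} {dS : measure_display} {S : measurableType dS}.
Variables (mu : probability S R) (G : 'rV[R]_d -> S -> 'rV[R]_d)
  (grad : 'rV[R]_d -> 'rV[R]_d) (sigma : R).
Hypothesis mG : forall i : 'I_d,
  measurable_fun [set: d.-tuple R * S] (fun p => G (row_of_tuple p.1) p.2 ord0 i).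
Hypothesis unbiased : forall x (i : 'I_d),
  mu.-integrable [set: S] (fun s => (G x s ord0 i)%:E) /\
  (\int[mu]_s (G x s ord0 i)%:E = (grad x ord0 i)%:E)%E.
Hypothesis variance : forall x,
  (\int[mu]_s ((norm2 (G x s - grad x)) ^+ 2)%:E <= (sigma ^+ 2)%:E)%E.

(* Each coordinate of grad is a difference of two Tonelli integrals of G. *)
Lemma measurable_grad_row :
  measurable_vec (fun t : d.-tuple R => grad (row_of_tuple t)).
Proof.
move=> i.
pose g (p : d.-tuple R * S) : \bar R := (G (row_of_tuple p.1) p.2 ord0 i)%:E.
have mg : measurable_fun [set: d.-tuple R * S] g by exact/measurable_EFinP.
have mpos := measurable_fun_fubini_tonelli_F (m2 := mu) _
  (measurable_funepos mg) (funepos_ge0 g).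
have mneg := measurable_fun_fubini_tonelli_F (m2 := mu) _
  (measurable_funeneg mg) (funeneg_ge0 g).
apply: eq_measurable_fun (measurable_funB
  (measurableT_comp (fine_measurable measurableT) mpos)
  (measurableT_comp (fine_measurable measurableT) mneg)) => t _ /=.
have [intG EG] := unbiased (row_of_tuple t) i.
apply: EFin_inj; rewrite EFinB -EG integralE /fubini_F.
have -> : (fun y => g^\+%E (t, y)) =
    (fun s => (G (row_of_tuple t) s ord0 i)%:E)^\+%E.
  by apply/funext => s; rewrite !funeposE.
have -> : (fun y => g^\-%E (t, y)) =
    (fun s => (G (row_of_tuple t) s ord0 i)%:E)^\-%E.
  by apply/funext => s; rewrite !funenegE.
by rewrite !fineK ?integrable_pos_fin_num ?integrable_neg_fin_num.
Qed.

Lemma measurable_oracle {dT : measure_display} {T : measurableType dT}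
    (x : T -> 'rV[R]_d) (s : T -> S) :
  measurable_vec x -> measurable_fun setT s -> measurable_vec (fun w => G (x w) (s w)).
Proof.
move=> mx ms i.
have mp : measurable_fun setT (fun w => (tuple_of_row (x w), s w)).
  by apply: measurable_fun_pair => //; exact: measurable_vec_tuple.
apply: eq_measurable_fun (measurableT_comp (mG i) mp) => w _ /=.
by rewrite tuple_of_rowK.
Qed.

Lemma measurable_grad {dT : measure_display} {T : measurableType dT}
    (x : T -> 'rV[R]_d) :
  measurable_vec x -> measurable_vec (fun w => grad (x w)).
Proof.
move=> mx i.
have H := measurableT_comp (measurable_grad_row i) (measurable_vec_tuple _ mx).
apply: eq_measurable_fun H => w _ /=.
by rewrite tuple_of_rowK.
Qed.

(** In the expanded square the term linear in the noise has mean zero by unbiasedness, and the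
    quadratic term is bounded by the variance. *)
Lemma noise_second_moment (x a : 'rV[R]_d) (b : R) :
  (\int[mu]_s (normsq (a + b *: (G x s - grad x)))%:E
    <= (normsq a + b ^+ 2 * sigma ^+ 2)%:E)%E.
Proof.
pose n s := G x s - grad x.
have mGx : measurable_vec (G x).
  by move=> i; exact/measurable_EFinP/measurable_int/(unbiased x i).1.
have mn : measurable_vec n by apply: measurable_vecB => // i; exact: measurable_cst.
have intn i : mu.-integrable setT (fun s => (n s ord0 i)%:E).
  have H := integrableB measurableT (unbiased x i).1
    (finite_measure_integrable_cst mu (grad x ord0 i) measurableT).
  by apply: eq_integrable H => // s _ /=; rewrite !mxE.
have En i : (\int[mu]_s (n s ord0 i)%:E = 0)%E.
  transitivity (\int[mu]_s ((G x s ord0 i)%:E - (grad x ord0 i)%:E))%E.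
    by apply: eq_integral => s _; rewrite !mxE.
  rewrite integralB ?(unbiased x i).2//; first 1 last.
    exact: (unbiased x i).1.
    exact: finite_measure_integrable_cst.
  by rewrite integral_cst//= probability_setT mule1 subee.
have intlin : mu.-integrable setT
    (fun s => \sum_(i < d) (2 * a ord0 i * b)%:E * (n s ord0 i)%:E)%E.
  by apply: integrable_sum => // i _; exact: integrableZl.
have Enorm : (\int[mu]_s (normsq (n s))%:E <= (sigma ^+ 2)%:E)%E.
  by have := variance x; under eq_integral do rewrite norm2_sqr.
have intnorm : mu.-integrable setT (fun s => (normsq (n s))%:E).
  apply/integrableP; split; first exact/measurable_EFinP/measurable_normsq.
  under eq_integral do rewrite gee0_abs ?lee_fin ?normsq_ge0//.
  exact: le_lt_trans Enorm (ltry _).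
have E s : (normsq (a + b *: n s))%:E =
    ((normsq a)%:E + \sum_(i < d) (2 * a ord0 i * b)%:E * (n s ord0 i)%:E
     + (b ^+ 2)%:E * (normsq (n s))%:E)%E.
  under eq_bigr do rewrite -EFinM.
  rewrite sumEFin -EFinM -!EFinD; congr EFin.
  rewrite /normsq mulr_sumr -!big_split/=; apply: eq_bigr => i _.
  rewrite !mxE; ring.
under eq_integral do rewrite E.
have intc : mu.-integrable setT (fun=> (normsq a)%:E).
  exact: finite_measure_integrable_cst.
rewrite integralD//; first 1 last.
  exact: integrableD.
  exact: integrableZl.
rewrite integralD// integral_cst//= probability_setT mule1.
rewrite integral_sum//; last by move=> i; exact: integrableZl.
rewrite big1 ?adde0; last by move=> i _; rewrite integralZl// En mule0.
rewrite integralZl// EFinD; apply: leeD2l.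
have b0 : (0 <= (b ^+ 2)%:E)%E by rewrite lee_fin sqr_ge0.
by rewrite [leRHS]EFinM; exact: lee_wpmul2l b0 _ _ Enorm.
Qed.

End Oracle.

(** * Descent along a sample path *)

Section Descent.
Context {R : realType} {d : nat}.
Implicit Types (x y v h : 'rV[R]_d).

Lemma dotvDl x y h : dotv (x + y) h = dotv x h + dotv y h.
Proof. by rewrite /dotv -big_split; apply: eq_bigr => i _; rewrite mxE mulrDl. Qed.

(** Coordinatewise this is $(a-Kb)^2/K\ge0$. With the Lipschitz constant as weight, both summands
    become equal in size in [smooth_descent]. *)
Lemma dotv_young x y (K : R) :
  0 < K -> dotv x y <= (normsq x / K + K * normsq y) / 2.
Proof.
move=> K0; rewrite ler_pdivlMr// /dotv /normsq !mulr_suml mulr_sumr -big_split/=.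
apply: ler_sum => i _; set a := x ord0 i; set b := y ord0 i.
have K0' := lt0r_neq0 K0.
have : 0 <= (a - K * b) ^+ 2 / K by rewrite divr_ge0 ?sqr_ge0 ?ltW.
suff -> : (a - K * b) ^+ 2 / K = a ^+ 2 / K + K * b ^+ 2 - a * b * 2 by lra.
by field.
Qed.

Lemma normsqZ (a : R) x : normsq (a *: x) = a ^+ 2 * normsq x.
Proof. by rewrite /normsq mulr_sumr; apply: eq_bigr => i _; rewrite mxE exprMn. Qed.

Lemma normsq_le (c : R) x :
  (forall i, `|x ord0 i| <= c) -> normsq x <= c ^+ 2 * d%:R.
Proof.
move=> xc; rewrite mulr_natr -[d in leRHS]card_ord -sumr_const.
apply: ler_sum => i _; rewrite -real_normK ?num_real//.
by rewrite ler_pXn2r// nnegrE// (le_trans _ (xc i)).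
Qed.

(** Follows from $(bu-w)^2/b\ge0$ in each coordinate. A small [b] keeps the factor on [x] close to
    1, so that a contraction can absorb it. *)
Lemma normsqD_young x y (b : R) : 0 < b ->
  normsq (x + y) <= (1 + b) * normsq x + (1 + b^-1) * normsq y.
Proof.
move=> b0; rewrite /normsq !mulr_sumr -big_split/=; apply: ler_sum => i _.
rewrite mxE; set u := x ord0 i; set w := y ord0 i.
have b0' := lt0r_neq0 b0.
have : 0 <= (b * u - w) ^+ 2 / b by rewrite divr_ge0 ?sqr_ge0 ?ltW.
suff -> : (b * u - w) ^+ 2 / b
  = (1 + b) * u ^+ 2 + (1 + b^-1) * w ^+ 2 - (u + w) ^+ 2 by lra.
by field.
Qed.

(** Sum of $(a|u|-1)^2/a\ge0$ over the coordinates. The bound is linear in [normsq], so it passes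
    directly to expectations. *)
Lemma norm1_young x (a : R) : 0 < a ->
  norm1 x <= (a * normsq x + d%:R / a) / 2.
Proof.
move=> a0; have a0' := lt0r_neq0 a0.
have -> : d%:R / a = \sum_(i < d) a^-1 by rewrite sumr_const card_ord mulr_natl.
rewrite /normsq /norm1 mulr_sumr -big_split/= mulr_suml.
apply: ler_sum => i _; set u := x ord0 i.
have : 0 <= (a * `|u| - 1) ^+ 2 / a by rewrite divr_ge0 ?sqr_ge0 ?ltW.
have -> : u ^+ 2 = `|u| ^+ 2 by rewrite real_normK ?num_real.
suff -> : (a * `|u| - 1) ^+ 2 / a = a * `|u| ^+ 2 + a^-1 - 2 * `|u| by lra.
by field.
Qed.

(** The mean value theorem on the segment replaces the integral remainder; the price is the constant
    [K] instead of [K / 2]. *)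
Lemma smooth_descent (f : 'rV[R]_d -> R) (grad : 'rV[R]_d -> 'rV[R]_d) (K : R) x h :
  (forall x v, is_derive x v f (dotv (grad x) v)) -> 0 < K ->
  (forall x y, normsq (grad x - grad y) <= K ^+ 2 * normsq (x - y)) ->
  f (x + h) <= f x + dotv (grad x) h + K * normsq h.
Proof.
move=> df K0 Lip.
pose phi (s : R) := f (x + s *: h).
have dphi (s : R) : is_derive s 1 phi (dotv (grad (x + s *: h)) h).
  have [dv ev] := df (x + s *: h) h.
  (* The difference quotient of [phi] at [s] is literally that of [f] at [x + s *: h] in direction
     [h], so the derivative transfers. *)
  have E : (fun t : R => t^-1 *: ((phi \o shift s) (t *: 1) - phi s)) =
      (fun t : R => t^-1 *: ((f \o shift (x + s *: h)) (t *: h) - f (x + s *: h))).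
    apply/funext => t; congr (_ *: (_ - _)); rewrite /phi/=; congr f.
    by rewrite [t%:A]mulr1 scalerDl addrCA.
  split; first by rewrite /derivable E.
  by rewrite /derive E.
have cphi : {within `[0, 1], continuous phi}.
  apply: derivable_within_continuous => s _; exact: (@ex_derive _ _ _ _ _ _ _ (dphi s)).
have [c c01] := MVT ltr01 (fun s _ => dphi s) cphi.
rewrite subr0 mulr1 /phi scale1r scale0r addr0 => E.
have -> : f (x + h) = f x + dotv (grad (x + c *: h)) h by rewrite -E [RHS]addrC subrK.
set g := grad (x + c *: h) - grad x.
have -> : grad (x + c *: h) = g + grad x by rewrite subrK.
rewrite dotvDl; suff : dotv g h <= K * normsq h by lra.
have gle : normsq g <= K ^+ 2 * normsq h.
  apply: le_trans (Lip _ _) _; rewrite addrAC subrr add0r normsqZ.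
  rewrite ler_wpM2l ?sqr_ge0// ler_piMl ?normsq_ge0//.
  move: c01; rewrite in_itv/= => /andP[c0 c1].
  by rewrite expr_le1 ?ltW.
apply: le_trans (dotv_young g h K K0) _.
have : normsq g / K <= K * normsq h by rewrite ler_pdivrMr// mulrAC -expr2.
lra.
Qed.

(** If the signs agree, the right side is $|g|$. Otherwise [v] is zero or across zero from [g], so
    $|g|\le|g-v|$ and the left side is at most $-|g|$. *)
Lemma mul_sgr_ge (g v : R) : `|g| - 2 * `|g - v| <= g * Num.sg v.
Proof.
case: (sgrP v) => v0; case: (ger0P g) => g0; case: (ger0P (g - v)) => gv;
  rewrite ?mulr0 ?mulr1 ?mulrN1; lra.
Qed.

Lemma dotv_signv_ge x v : norm1 x - 2 * norm1 (x - v) <= dotv x (signv v).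
Proof.
rewrite /norm1 /dotv mulr_sumr -sumrB; apply: ler_sum => i _.
by rewrite !mxE; exact: mul_sgr_ge.
Qed.

Lemma dotv_norm1_le x y (c : R) :
  (forall i, `|y ord0 i| <= c) -> `|dotv x y| <= c * norm1 x.
Proof.
move=> yc; apply: le_trans (ler_norm_sum _ _ _) _.
by rewrite /norm1 mulr_sumr; apply: ler_sum => i _; rewrite normrM mulrC ler_wpM2r.
Qed.

End Descent.

(** * The Lion recursion for a fixed sequence of samples *)

Section LionPath.
Context {R : realType} {d : nat} {S : Type}.
Variables (G : 'rV[R]_d -> S -> 'rV[R]_d) (s : nat -> S) (b1 b2 eta lam : R)
  (x1 : 'rV[R]_d).
Local Notation X n := (lion_state G s b1 b2 eta lam x1 n).1.
Local Notation M n := (lion_state G s b1 b2 eta lam x1 n).2.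

(** Common form of both averages: [c = b1] gives $v_{n+1}$ and [c = b2] gives $m_{n+1}$. The case
    [n = 0] is the first iteration. *)
Definition momentum (n : nat) (c : R) (m g : 'rV[R]_d) : 'rV[R]_d :=
  if n == 0%N then g else (1 - c) *: m + c *: g.

Local Notation V n := (momentum n b1 (M n) (G (X n) (s n.+1))).

Lemma lion_iterateS n : X n.+1 = X n - eta *: (signv (V n) + lam *: X n).
Proof. by []. Qed.

Lemma sgr_le1 (a : R) : `|Num.sg a| <= 1.
Proof. by rewrite normr_sg; case: (a != 0). Qed.

Hypotheses (eta_gt0 : 0 < eta) (lam_ge0 : 0 <= lam) (lam_eta : lam * eta <= 1).
Hypothesis x1_le : forall i, `|x1 ord0 i| <= eta.

(** The update multiplies each entry by $1-\lambda\eta\in[0,1]$ and then moves it by at most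
    [eta]. *)
Lemma lion_iterate_bound n i : `|X n ord0 i| <= n.+1%:R * eta.
Proof.
elim: n => [|n IH]; first by rewrite mul1r.
rewrite lion_iterateS !mxE.
set x := X n ord0 i in IH *; set g := Num.sg _.
have -> : x - eta * (g + lam * x) = (1 - lam * eta) * x - eta * g by ring.
apply: le_trans (ler_normB _ _) _.
rewrite !normrM (gtr0_norm eta_gt0) [`|1 - _|]ger0_norm ?subr_ge0//.
have le_etag : eta * `|g| <= eta by rewrite ler_piMr ?sgr_le1 ?ltW.
have le_x : (1 - lam * eta) * `|x| <= n.+1%:R * eta.
  apply: le_trans IH; rewrite ler_piMl// gerBl; exact: mulr_ge0 lam_ge0 (ltW eta_gt0).
have -> : n.+2%:R * eta = n.+1%:R * eta + eta by rewrite -[n.+2%:R]natr1 mulrDl mul1r.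
exact: lerD.
Qed.

Variables (T : nat).
Hypothesis (T_gt0 : (0 < T)%N) (lamT : lam <= (2 * eta * T%:R)^-1).

Lemma lion_decay_bound n i : (n < T)%N -> lam * `|X n ord0 i| <= 2^-1.
Proof.
move=> nT; have T0 : 0 < T%:R :> R by rewrite ltr0n.
have xT : `|X n ord0 i| <= T%:R * eta.
  by apply: le_trans (lion_iterate_bound n i) _; rewrite ler_pM2r// ler_nat.
apply: le_trans (ler_pM lam_ge0 (normr_ge0 _) lamT xT) _.
rewrite le_eqVlt; apply/orP; left; apply/eqP; field.
by rewrite !lt0r_neq0.
Qed.

Lemma lion_displacement n : (n < T)%N ->
  normsq (eta *: (signv (V n) + lam *: X n)) <= 9 / 4 * (eta ^+ 2 * d%:R).
Proof.
(* An entry of the direction is at most 1 from the sign plus 1/2 from the decay. *)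
move=> nT; rewrite (_ : 9 / 4 * _ = (3 / 2 * eta) ^+ 2 * d%:R); last by field.
apply: normsq_le => i; rewrite !mxE normrM (gtr0_norm eta_gt0) [leRHS]mulrC.
rewrite ler_pM2l//; apply: le_trans (ler_normD _ _) _.
rewrite normrM (ger0_norm lam_ge0).
have := lion_decay_bound n i nT.
set g := Num.sg _; have := sgr_le1 (V n ord0 i : R); rewrite -/g; lra.
Qed.

Variables (f : 'rV[R]_d -> R) (grad : 'rV[R]_d -> 'rV[R]_d) (K : R).
Hypothesis df : forall x v, is_derive x v f (dotv (grad x) v).
Hypothesis (K_gt0 : 0 < K).
Hypothesis Lip : forall x y, normsq (grad x - grad y) <= K ^+ 2 * normsq (x - y).

Lemma lion_descent n : (n < T)%N ->
  eta / 2 * norm1 (grad (X n)) <= f (X n) - f (X n.+1)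
    + 2 * eta * norm1 (V n - grad (X n)) + 9 / 4 * K * (eta ^+ 2 * d%:R).
Proof.
move=> nT; rewrite lion_iterateS; set x := X n; set v := V n.
set u := signv v + lam *: x.
have := smooth_descent f grad K x (- (eta *: u)) df K_gt0 Lip.
have normsqN (y : 'rV[R]_d) : normsq (- y) = normsq y.
  by rewrite /normsq; apply: eq_bigr => i _; rewrite mxE sqrrN.
rewrite normsqN.
have := lion_displacement n nT; rewrite -/x -/v -/u => hu.
have {}hu := ler_wpM2l (ltW K_gt0) hu.
have -> : dotv (grad x) (- (eta *: u))
    = - eta * (dotv (grad x) (signv v) + dotv (grad x) (lam *: x)).
  rewrite /dotv -big_split mulr_sumr; apply: eq_bigr => i _; rewrite /u !mxE/=.
  by move: (grad x _ _) (Num.sg _) (x _ _) => a b c; ring.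
have sg_ge := dotv_signv_ge (grad x) v.
have norm1C : norm1 (grad x - v) = norm1 (v - grad x).
  by rewrite /norm1; apply: eq_bigr => i _; rewrite !mxE distrC.
have dx : `|dotv (grad x) (lam *: x)| <= 2^-1 * norm1 (grad x).
  apply: dotv_norm1_le => i; rewrite mxE normrM (ger0_norm lam_ge0).
  exact: lion_decay_bound.
have {}dx : - (2^-1 * norm1 (grad x)) <= dotv (grad x) (lam *: x).
  by move: dx; rewrite ler_norml => /andP[].
rewrite norm1C in sg_ge.
set A := dotv (grad x) (signv v) in sg_ge *.
set B := dotv (grad x) (lam *: x) in dx *.
(* The sign term gains the full l1-norm up to the update error, and the decay term can undo at most
   half of it. *)
have AB : 0 <= A + B - (2^-1 * norm1 (grad x) - 2 * norm1 (v - grad x)) by lra.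
have := mulr_ge0 (ltW eta_gt0) AB; lra.
Qed.

Lemma lion_descent_sum n : (n <= T)%N ->
  eta / 2 * \sum_(k < n) norm1 (grad (X k)) <= f x1 - f (X n)
    + 2 * eta * (\sum_(k < n) norm1 (V k - grad (X k)))
    + n%:R * (9 / 4 * K * (eta ^+ 2 * d%:R)).
Proof.
elim: n => [|n IH] nT; first by rewrite !big_ord0 mul0r !mulr0 subrr !addr0.
have := IH (ltnW nT); have := lion_descent n nT.
rewrite !big_ord_recr /= -/(lion_state G s b1 b2 eta lam x1 n).
rewrite -[n.+1%:R]natr1.
set A := \sum_(k < n) _; set B := \sum_(k < n) _.
lra.
Qed.

End LionPath.

(** * Second moments of the momentum error *)

Section LionMoments.
Context {R : realType} {d : nat} {dS dO : measure_display}
  {S : measurableType dS} {Omega : measurableType dO}.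
Variables (mu : probability S R) (P : probability Omega R)
  (G : 'rV[R]_d -> S -> 'rV[R]_d) (grad : 'rV[R]_d -> 'rV[R]_d) (sigma : R)
  (xi : nat -> Omega -> S) (b1 b2 eta lam : R) (x1 : 'rV[R]_d).
Hypothesis mG : forall i : 'I_d,
  measurable_fun [set: d.-tuple R * S] (fun p => G (row_of_tuple p.1) p.2 ord0 i).
Hypothesis unbiased : forall x (i : 'I_d),
  mu.-integrable [set: S] (fun s => (G x s ord0 i)%:E) /\
  (\int[mu]_s (G x s ord0 i)%:E = (grad x ord0 i)%:E)%E.
Hypothesis variance : forall x,
  (\int[mu]_s ((norm2 (G x s - grad x)) ^+ 2)%:E <= (sigma ^+ 2)%:E)%E.
Hypothesis mxi : forall t, measurable_fun [set: Omega] (xi t).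
Hypothesis lawxi : forall t (A : set S), measurable A -> P (xi t @^-1` A) = mu A.
Hypothesis ixi : mutually_independent P xi.

Local Notation st n w := (lion_state G (fun k => xi k w) b1 b2 eta lam x1 n).
Local Notation X n w := (st n w).1.
Local Notation M n w := (st n w).2.
Local Notation g n w := (G (X n w) (xi n.+1 w)).

(** Iterate and momentum are stored as tuples to carry a product sigma-algebra; [step] is then one
    deterministic update of state and sample. *)
Let state := (d.-tuple R * d.-tuple R)%type.

Let encode (n : nat) (w : Omega) : state :=
  (tuple_of_row (X n w), tuple_of_row (M n w)).

Let step (n : nat) (p : state * S) : state :=
  let x := row_of_tuple p.1.1 in let m := row_of_tuple p.1.2 in
  let g := G x p.2 in
  (tuple_of_row (x - eta *: (signv (momentum n b1 m g) + lam *: x)),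
   tuple_of_row (momentum n b2 m g)).

Lemma measurable_momentum {dT : measure_display} {T : measurableType dT} n c
    (m h : T -> 'rV[R]_d) :
  measurable_vec m -> measurable_vec h ->
  measurable_vec (fun w => momentum n c (m w) (h w)).
Proof.
rewrite /momentum; case: (n == 0%N) => // mm mh.
by apply: measurable_vecD; exact: measurable_vecZ.
Qed.

Let measurable_step n : measurable_fun setT (step n).
Proof.
have mx : measurable_vec (fun p : state * S => row_of_tuple p.1.1).
  apply: measurable_vec_row; exact: measurableT_comp measurable_fst.
have mm : measurable_vec (fun p : state * S => row_of_tuple p.1.2).
  apply: measurable_vec_row; exact: measurableT_comp measurable_fst.
have mg : measurable_vec (fun p : state * S => G (row_of_tuple p.1.1) p.2).
  exact: measurable_oracle.
apply: measurable_fun_pair; apply: measurable_vec_tuple;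
  last exact: measurable_momentum.
apply: measurable_vecB => //; apply: measurable_vecZ; apply: measurable_vecD.
  by apply: measurable_signv; exact: measurable_momentum.
exact: measurable_vecZ.
Qed.

Let encode_fresh n : measurable_fun setT (encode n) /\
  forall B A, measurable B -> measurable A ->
  P (encode n @^-1` B `&` xi n.+1 @^-1` A) = (P (encode n @^-1` B) * P (xi n.+1 @^-1` A))%E.
Proof.
(* The initial state is the same for every outcome, so its value at [point] names the constant. *)
apply: (fresh_sample_indep P xi step encode (encode 0%N point)) => //.
by move=> k w; rewrite /step /encode /= !tuple_of_rowK.
Qed.

Lemma measurable_lion n :
  measurable_vec (fun w => X n w) /\ measurable_vec (fun w => M n w).
Proof.
have [me _] := encode_fresh n.
have m1 := measurable_vec_row _ (measurableT_comp measurable_fst me).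
have m2 := measurable_vec_row _ (measurableT_comp measurable_snd me).
split => i.
  by apply: eq_measurable_fun (m1 i) => w _; rewrite /= tuple_of_rowK.
by apply: eq_measurable_fun (m2 i) => w _; rewrite /= tuple_of_rowK.
Qed.

Lemma measurable_lion_grad n k : measurable_vec (fun w => M n w - grad (X k w)).
Proof.
apply: measurable_vecB; first by have [] := measurable_lion n.
by apply: (measurable_grad mu G) => //; have [] := measurable_lion k.
Qed.

(* The cross term vanishes because xi (n+1) is independent of (X n, M n). *)
Lemma lion_noise_moment n (A : 'rV[R]_d -> 'rV[R]_d -> 'rV[R]_d) (c : R) :
  measurable_vec (fun p : state => A (row_of_tuple p.1) (row_of_tuple p.2)) ->
  (\int[P]_w (normsq (A (X n w) (M n w) + c *: (g n w - grad (X n w))))%:E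
   <= \int[P]_w (normsq (A (X n w) (M n w)))%:E + (c ^+ 2 * sigma ^+ 2)%:E)%E.
Proof.
move=> mA; have [me ie] := encode_fresh n.
pose F (z : state * S) : \bar R :=
  (normsq (A (row_of_tuple z.1.1) (row_of_tuple z.1.2)
    + c *: (G (row_of_tuple z.1.1) z.2 - grad (row_of_tuple z.1.1))))%:E.
have mx : measurable_vec (fun p : state * S => row_of_tuple p.1.1).
  apply: measurable_vec_row; exact: measurableT_comp measurable_fst.
have mF : measurable_fun [set: state * S] F.
  apply/measurable_EFinP/measurable_normsq/measurable_vecD.
    by move=> i; exact: (measurableT_comp (mA i) measurable_fst).
  apply/measurable_vecZ/measurable_vecB; first exact: measurable_oracle.
  exact: (measurable_grad mu G).
have F0 z : (0 <= F z)%E by rewrite lee_fin normsq_ge0.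
have FE w s : F (encode n w, s) =
    (normsq (A (X n w) (M n w) + c *: (G (X n w) s - grad (X n w))))%:E.
  by rewrite /F /= !tuple_of_rowK.
have mAXM : measurable_vec (fun w => A (X n w) (M n w)).
  move=> i; have H := measurableT_comp (mA i) me.
  by apply: eq_measurable_fun H => w _; rewrite /= !tuple_of_rowK.
rewrite (eq_integral (fun w => F (encode n w, xi n.+1 w))); last first.
  by move=> w _; rewrite FE.
(* With the state frozen in the inner integral, [noise_second_moment] applies pointwise in the
   outcome. *)
rewrite (integral_indep_pair P mu) //; last exact: lawxi.
have <- : (\int[P]_w (c ^+ 2 * sigma ^+ 2)%:E = (c ^+ 2 * sigma ^+ 2)%:E)%E.
  by rewrite integral_cst//= probability_setT mule1.
rewrite -ge0_integralD//; first last.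
- by move=> w _; rewrite lee_fin mulr_ge0 ?sqr_ge0.
- exact/measurable_EFinP/measurable_normsq.
- by move=> w _; rewrite lee_fin normsq_ge0.
apply: ge0_le_integral => //.
- by move=> w _; exact: integral_ge0.
- have H := measurable_fun_fubini_tonelli_F (m2 := mu) F mF F0.
  exact: (measurableT_comp H me).
- by apply: emeasurable_funD => //; exact/measurable_EFinP/measurable_normsq.
move=> w _; under eq_integral do rewrite FE.
by rewrite -EFinD; exact: noise_second_moment.
Qed.

(** The new error splits as [(1 - c)] times the old error, measured at the same point [X n], plus
    [c] times fresh noise. At [n = 0] only the noise is present. *)
Lemma momentum_error n c : 0 <= c -> c <= 1 ->
  (\int[P]_w (normsq (momentum n c (M n w) (g n w) - grad (X n w)))%:E <=
   if n == 0%N then (sigma ^+ 2)%:E else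
   ((1 - c) ^+ 2)%:E * \int[P]_w (normsq (M n w - grad (X n w)))%:E
     + (c ^+ 2 * sigma ^+ 2)%:E)%E.
Proof.
move=> c0 c1; rewrite /momentum; case: ifPn => [_|n0].
  have m0 : measurable_vec (fun _ : state => 0 : 'rV[R]_d).
    by move=> i; exact: measurable_cst.
  have := lion_noise_moment n (fun _ _ => 0) 1 m0.
  have -> : normsq (0 : 'rV[R]_d) = 0.
    by rewrite /normsq big1// => i _; rewrite mxE expr0n.
  rewrite integral0 add0e expr1n mul1r.
  by under eq_integral do rewrite add0r scale1r.
have mA : measurable_vec (fun p : state =>
    (1 - c) *: (row_of_tuple p.2 - grad (row_of_tuple p.1))).
  apply/measurable_vecZ/measurable_vecB; first exact: measurable_vec_row.
  by apply: (measurable_grad mu G) => //; exact: measurable_vec_row.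
have := lion_noise_moment n (fun x m => (1 - c) *: (m - grad x)) c mA.
under [leLHS]eq_integral.
  move=> w _.
  rewrite (_ : _ + _ = (1 - c) *: M n w + c *: g n w - grad (X n w)); last first.
    by apply/rowP => i; rewrite !mxE; ring.
  over.
under [in leRHS]eq_integral do rewrite normsqZ EFinM.
rewrite ge0_integralZl_EFin ?sqr_ge0//.
- by move=> w _; rewrite lee_fin normsq_ge0.
- by apply/measurable_EFinP/measurable_normsq; exact: measurable_lion_grad.
Qed.

Variables (K D : R) (T : nat).
Hypothesis Lip : forall x y, normsq (grad x - grad y) <= K ^+ 2 * normsq (x - y).
Hypothesis displ : forall n w, (n < T)%N ->
  normsq (X n w - X n.+1 w) <= D.
Hypotheses (b2_gt0 : 0 < b2) (b2_le1 : b2 <= 1).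
Let b2_ge0 : 0 <= b2 := ltW b2_gt0.

Let drift := K ^+ 2 * D.
(** The fixed point of $q\mapsto(1-b_2)q+2b_2^2\sigma^2+2\,\mathrm{drift}/b_2$, the recursion that
    dominates the tracking error. *)
Let noise_floor := 2 * b2 * sigma ^+ 2 + 2 * drift / b2 ^+ 2.

(** Each iteration alternates two effects: averaging in a fresh sample contracts the error at [X k],
    and moving the gradient to [X k.+1] adds drift. The excess over [noise_floor] decays
    geometrically. *)
Lemma lion_tracking_error n : (n < T)%N ->
  (\int[P]_w (normsq (M n.+1 w - grad (X n.+1 w)))%:E
   <= ((1 - b2) ^+ n * (2 * sigma ^+ 2) + noise_floor)%:E)%E.
Proof.
move=> nT.
have D0 : 0 <= D.
  apply: le_trans (displ n point nT); exact: normsq_ge0.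
have drift0 : 0 <= drift by rewrite mulr_ge0// sqr_ge0.
have noise_floor0 : 0 <= noise_floor.
  have s0 := sqr_ge0 sigma; have bb0 := sqr_ge0 b2.
  apply: addr_ge0; last by apply: divr_ge0 => //; exact: mulr_ge0.
  by apply: mulr_ge0 => //; exact: mulr_ge0.
have b2N : b2 != 0 by rewrite lt0r_neq0.
(* Young with weight [b2]: the inflation [1 + b2] is small enough to be paid for by the
   contraction. *)
have E1 k : (k < T)%N ->
  (\int[P]_w (normsq (M k.+1 w - grad (X k.+1 w)))%:E <=
   (1 + b2)%:E * \int[P]_w (normsq (M k.+1 w - grad (X k w)))%:E
     + ((1 + b2^-1) * drift)%:E)%E.
  move=> kT.
  have <- : (\int[P]_w ((1 + b2^-1) * drift)%:E = ((1 + b2^-1) * drift)%:E)%E.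
    by rewrite integral_cst//= probability_setT mule1.
  have c0 : 0 <= (1 + b2^-1) * drift by rewrite mulr_ge0// addr_ge0// invr_ge0.
  rewrite -ge0_integralZl_EFin//; first last.
  - by rewrite addr_ge0//.
  - by apply/measurable_EFinP/measurable_normsq; exact: measurable_lion_grad.
  - by move=> w _; rewrite lee_fin normsq_ge0.
  have mk : measurable_fun setT
      (fun w => (1 + b2)%:E * (normsq (M k.+1 w - grad (X k w)))%:E)%E.
    apply: emeasurable_funM => //.
    by apply/measurable_EFinP/measurable_normsq; exact: measurable_lion_grad.
  rewrite -ge0_integralD//; first last.
    by move=> w _; rewrite -EFinM lee_fin mulr_ge0 ?normsq_ge0// addr_ge0//.
  apply: ge0_le_integral => //.
  - by move=> w _; rewrite lee_fin normsq_ge0.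
  - by apply/measurable_EFinP/measurable_normsq; exact: measurable_lion_grad.
  - by apply: emeasurable_funD.
  move=> w _; rewrite -EFinM -EFinD lee_fin.
  have -> : M k.+1 w - grad (X k.+1 w)
    = (M k.+1 w - grad (X k w)) + (grad (X k w) - grad (X k.+1 w)).
    by rewrite addrA subrK.
  apply: le_trans (normsqD_young _ _ _ b2_gt0) _.
  rewrite lerD2l ler_wpM2l ?addr_ge0 ?invr_ge0//.
  apply: le_trans (Lip _ _) _; rewrite ler_wpM2l ?sqr_ge0//; exact: displ.
have E2 k := momentum_error k b2 (ltW b2_gt0) b2_le1.
have noise_floor_fix : b2 * noise_floor = 2 * b2 ^+ 2 * sigma ^+ 2 + 2 * drift / b2.
  by rewrite /noise_floor; field.
have drift_le : (1 + b2^-1) * drift <= 2 * drift / b2.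
  have -> : (1 + b2^-1) * drift = (1 + b2) * (drift / b2) by field.
  rewrite -mulrA; apply: ler_wpM2r; first exact: divr_ge0.
  by move: b2_le1; lra.
have b2s : 0 <= b2 ^+ 2 * sigma ^+ 2 by rewrite mulr_ge0 ?sqr_ge0.
have b21 : (0 <= (1 + b2)%:E)%E.
  by rewrite lee_fin addr_ge0//.
elim: n nT => [|n IH] nT.
  apply: le_trans (E1 0%N nT) _.
  have H := lee_wpmul2l b21 (E2 0%N); rewrite /= in H.
  apply: le_trans (leeD2r _ H) _.
  rewrite -EFinM -EFinD lee_fin expr0 mul1r.
  (* At the start the error is one raw noise, inflated by [1 + b2 <= 2]; this is the source of
     [2 * sigma ^+ 2]. The first drift fits under the floor. *)
  have f1 : b2 * noise_floor <= noise_floor.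
    by rewrite ler_piMl.
  have : (1 + b2) * sigma ^+ 2 <= 2 * sigma ^+ 2 
    by apply: ler_wpM2r; [exact: sqr_ge0|move: b2_le1; lra].
  lra.
apply: le_trans (E1 n.+1 nT) _.
have H := lee_wpmul2l b21 (E2 n.+1); rewrite /= in H.
apply: le_trans (leeD2r _ H) _.
have {}IH := IH (ltnW nT).
have c2 : (0 <= ((1 - b2) ^+ 2)%:E)%E by rewrite lee_fin sqr_ge0.
have {}IH := lee_wpmul2l b21 (leeD2r (b2 ^+ 2 * sigma ^+ 2)%:E (lee_wpmul2l c2 IH)).
apply: le_trans (leeD2r _ IH) _.
rewrite -EFinM -EFinD lee_fin.
set q := (1 - b2) ^+ n * (2 * sigma ^+ 2) + noise_floor.
have -> : (1 - b2) ^+ n.+1 * (2 * sigma ^+ 2) + noise_floor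
  = (1 - b2) * q + b2 * noise_floor by rewrite /q exprS; ring.
have q0 : 0 <= q.
  apply: addr_ge0 => //; apply: mulr_ge0; first by rewrite exprn_ge0 ?subr_ge0.
  by apply: mulr_ge0 => //; exact: sqr_ge0.
(* The contraction beats the inflation because $(1+b_2)(1-b_2)=1-b_2^2\le1$, which leaves one factor
   $1-b_2$. *)
have h1 : (1 + b2) * (1 - b2) ^+ 2 * q <= (1 - b2) * q.
  rewrite ler_wpM2r// expr2 mulrA ler_piMl ?subr_ge0//.
  have -> : (1 + b2) * (1 - b2) = 1 - b2 ^+ 2 by ring.
  by rewrite gerBl sqr_ge0.
have h2 : (1 + b2) * (b2 ^+ 2 * sigma ^+ 2) <= 2 * (b2 ^+ 2 * sigma ^+ 2).
  by apply: ler_wpM2r => //; move: b2_le1; lra.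
lra.
Qed.

(** The direction is the old momentum averaged once with weight [b1]: the old error is not
    amplified, and the new noise costs at most [b2 * sigma ^+ 2]. The exponent [n.-1] also covers
    the first iteration, where the error is pure noise. *)
Lemma lion_update_error n : (n < T)%N -> 0 <= b1 -> b1 <= 1 -> b1 ^+ 2 <= b2 ->
  (\int[P]_w (normsq (momentum n b1 (M n w) (g n w) - grad (X n w)))%:E
   <= ((1 - b2) ^+ n.-1 * (2 * sigma ^+ 2) + noise_floor + b2 * sigma ^+ 2)%:E)%E.
Proof.
move=> nT b10 b11 b1b2; apply: le_trans (momentum_error n b1 b10 b11) _.
have D0 : 0 <= D.
  apply: le_trans (displ n point nT); exact: normsq_ge0.
have drift0 : 0 <= drift by rewrite mulr_ge0// sqr_ge0.
have s0 := sqr_ge0 sigma; have bs0 := mulr_ge0 b2_ge0 s0; have bb0 := sqr_ge0 b2.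
have noise_floor0 : 0 <= noise_floor.
  apply: addr_ge0; last by apply: divr_ge0 => //; exact: mulr_ge0.
  by apply: mulr_ge0 => //; exact: mulr_ge0.
case: n nT => [|n] nT /=; first by rewrite lee_fin expr0; lra.
have c2 : (0 <= ((1 - b1) ^+ 2)%:E)%E by rewrite lee_fin sqr_ge0.
apply: le_trans (leeD2r _ (lee_wpmul2l c2 (lion_tracking_error n (ltnW nT)))) _.
rewrite -EFinM -EFinD lee_fin; apply: lerD; last by rewrite ler_wpM2r.
rewrite ler_piMl//.
  apply: addr_ge0 => //; apply: mulr_ge0; first by rewrite exprn_ge0 ?subr_ge0.
  exact: mulr_ge0.
by rewrite expr_le1 ?subr_ge0// gerBl.
Qed.

End LionMoments.

(** * The convergence rate *)

(** Takes expectations in a pathwise bound. Since all terms are nonnegative, sums and integrals are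
    exchanged in the extended reals. *)
Lemma sum_integral_le {R : realType} {dO : measure_display}
    {Omega : measurableType dO} (P : probability Omega R) (T : nat)
    (u v : nat -> Omega -> R) (r : nat -> R) (c0 c1 : R) :
  (forall n, measurable_fun setT (u n)) -> (forall n, measurable_fun setT (v n)) ->
  (forall n w, 0 <= u n w) -> (forall n w, 0 <= v n w) -> 0 <= c0 -> 0 <= c1 ->
  (forall w, \sum_(n < T) u n w <= c0 + c1 * \sum_(n < T) v n w) ->
  (forall n, (n < T)%N -> (\int[P]_w (v n w)%:E <= (r n)%:E)%E) ->
  (\sum_(n < T) \int[P]_w (u n w)%:E <= (c0 + c1 * \sum_(n < T) r n)%:E)%E.
Proof.
move=> mu mv u0 v0 c00 c10 uv vr.
have mE (h : nat -> Omega -> R) (n : 'I_T) : (forall k, measurable_fun setT (h k)) ->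
    measurable_fun setT (fun w => (h n w)%:E).
  by move=> mh; exact/measurable_EFinP.
rewrite -ge0_integral_sum//; first last.
- by move=> n w _; rewrite lee_fin.
- by move=> n; exact: mE.
have mS : measurable_fun setT (fun w => \sum_(n < T) (v n w)%:E)%E.
  by apply: emeasurable_sum => n; exact: mE.
have S0 w : (0 <= \sum_(n < T) (v n w)%:E)%E.
  by apply: sume_ge0 => n _; rewrite lee_fin.
have mcS : measurable_fun setT (fun w => c1%:E * \sum_(n < T) (v n w)%:E)%E.
  exact: emeasurable_funM.
apply: (@le_trans _ _ (\int[P]_w (c0%:E + c1%:E * \sum_(n < T) (v n w)%:E))%E).
  apply: ge0_le_integral => //.
  - by move=> w _; apply: sume_ge0 => n _; rewrite lee_fin.
  - by apply: emeasurable_sum => n; exact: mE.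
  - exact: emeasurable_funD.
  by move=> w _; rewrite !sumEFin -EFinM -EFinD lee_fin.
rewrite ge0_integralD//; last first.
  by move=> w _; apply: mule_ge0.
rewrite integral_cst//= probability_setT mule1 EFinD; apply: leeD2l.
rewrite ge0_integralZl_EFin// EFinM; apply: lee_wpmul2l => //.
rewrite ge0_integral_sum//; first last.
- by move=> n w _; rewrite lee_fin.
- by move=> n; exact: mE.
by rewrite -sumEFin; apply: lee_sum => n _; exact: vr.
Qed.

Lemma geometric_sum_le {R : realType} (b : R) (T : nat) : 0 < b -> b <= 1 ->
  \sum_(n < T) (1 - b) ^+ n.-1 <= 1 + b^-1.
Proof.
move=> b0 b1; case: T => [|T].
  by rewrite big_ord0 addr_ge0// invr_ge0 ltW.
(* Exponent 0 occurs for both [n = 0] and [n = 1]; the duplicate gives the extra 1. *)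
rewrite big_ord_recl expr0 lerD2l; under eq_bigr do rewrite /= add0n.
have bS : b * \sum_(n < T) (1 - b) ^+ n = 1 - (1 - b) ^+ T.
  elim: T => [|T IH]; first by rewrite big_ord0 mulr0 expr0 subrr.
  by rewrite big_ord_recr/= mulrDr IH exprS; ring.
rewrite -(ler_pM2l b0) bS mulfV ?lt0r_neq0// gerBl exprn_ge0//; lra.
Qed.

(** Here [tau] is $T^{1/4}$ and [sd] is $\sqrt d$, so all exponents are integers. Each term is a
    multiple of [sd / tau], two of them with a spare factor [(tau ^+ 2)^-1], at most 1. *)
Lemma lion_rate_bound {R : realType} (tau sd K sigma Df cb ce eta b : R) :
  1 <= tau -> 0 < sd -> 0 < cb -> 0 < ce -> 0 < K ->
  eta = ce * sd^-1 * (tau ^+ 3)^-1 -> b = cb * (tau ^+ 2)^-1 ->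
  (tau ^+ 4)^-1 * (2 * Df / eta + 2 * tau ^+ 4 * sd / tau
      + tau ^+ 4 * (9 / 2 * K * eta * sd ^+ 2)
    + 2 * (sd * tau) * ((1 + b^-1) * (2 * sigma ^+ 2)
      + tau ^+ 4 * (2 * b * sigma ^+ 2
        + 2 * (K ^+ 2 * (9 / 4 * (eta ^+ 2 * sd ^+ 2))) / b ^+ 2
        + b * sigma ^+ 2)))
  <= (2 * Df / ce + 2 + 9 / 2 * K * ce + 2 * (2 * sigma ^+ 2 + 2 * sigma ^+ 2 / cb
       + 3 * cb * sigma ^+ 2 + 9 / 2 * K ^+ 2 * ce ^+ 2 / cb ^+ 2)) * sd / tau.
Proof.
move=> tau1 sd0 cb0 ce0 K0 -> ->.
have tau0 : 0 < tau by lra.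
set lhs := (X in X <= _).
have -> : lhs = (2 * Df / ce + 2 + 9 / 2 * K * ce * (tau ^+ 2)^-1
   + 2 * (2 * sigma ^+ 2 * (tau ^+ 2)^-1 + 2 * sigma ^+ 2 / cb
       + 3 * cb * sigma ^+ 2 + 9 / 2 * K ^+ 2 * ce ^+ 2 / cb ^+ 2)) * sd / tau.
  by rewrite /lhs; field; rewrite ?lt0r_neq0.
rewrite ler_pM2r ?invr_gt0// ler_pM2r//.
have y1 : (tau ^+ 2)^-1 <= 1.
  by rewrite invf_le1 ?exprn_gt0// expr_ge1// ltW.
have h1 : K * (ce * (tau ^+ 2)^-1) <= K * (ce * 1).
  by rewrite !ler_pM2l.
have h2 : sigma ^+ 2 * (tau ^+ 2)^-1 <= sigma ^+ 2 * 1.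
  by apply: ler_wpM2l => //; exact: sqr_ge0.
lra.
Qed.

Lemma fourth_root_powers {R : realType} (x : R) : 0 <= x ->
  [/\ x `^ (- (1 / 2)) = ((x `^ (1 / 4)) ^+ 2)^-1,
      x `^ (- (3 / 4)) = ((x `^ (1 / 4)) ^+ 3)^-1 & x = (x `^ (1 / 4)) ^+ 4].
Proof.
move=> x0; rewrite -!powR_mulrn ?powR_ge0// -!powRrM !powRN.
split; [congr (_^-1); congr powR; lra|congr (_^-1); congr powR; lra|].
rewrite (_ : 1 / 4 * 4%:R = 1) ?powRr1//; lra.
Qed.

Theorem theorem1 (R : realType) (L sigma Df cb ce : R) :
  0 < cb -> 0 < ce ->
  exists C : R,
  forall (d : nat) (f : 'rV[R]_d -> R) (grad : 'rV[R]_d -> 'rV[R]_d)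
    (dS : measure_display) (S : measurableType dS) (mu : probability S R)
    (G : 'rV[R]_d -> S -> 'rV[R]_d)
    (dO : measure_display) (Omega : measurableType dO) (P : probability Omega R)
    (xi : nat -> Omega -> S)
    (T : nat) (b1 b2 eta lam : R) (x1 : 'rV[R]_d),
  (0 < d)%N ->
  (* grad is the gradient of f *)
  (forall x v : 'rV[R]_d, is_derive x v f (dotv (grad x) v)) ->
  (* (A1) *)
  (forall x y, norm2 (grad x - grad y) <= L * norm2 (x - y)) ->
  (* the oracle is (jointly) measurable *)
  (forall i : 'I_d,
     measurable_fun [set: d.-tuple R * S]
       (fun p => G (row_of_tuple p.1) p.2 ord0 i)) ->
  (* (A3) *)
  (forall x (i : 'I_d),
     mu.-integrable [set: S] (fun s => (G x s ord0 i)%:E) /\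
     (\int[mu]_s (G x s ord0 i)%:E = (grad x ord0 i)%:E)%E) ->
  (forall x, (\int[mu]_s ((norm2 (G x s - grad x)) ^+ 2)%:E <= (sigma ^+ 2)%:E)%E) ->
  (* (A4) *)
  has_lbound (range f) ->
  f x1 - inf (range f) <= Df ->
  (* fresh i.i.d. samples with law mu *)
  (forall t, measurable_fun [set: Omega] (xi t)) ->
  (forall t (A : set S), measurable A -> P (xi t @^-1` A) = mu A) ->
  mutually_independent P xi ->
  (* parameters *)
  (1 <= T)%N ->
  b2 = cb * (T%:R) `^ (- (1 / 2)) -> b2 <= 1 ->
  b2 ^+ 2 <= b1 -> b1 <= Num.sqrt b2 ->
  eta = ce * (Num.sqrt d%:R)^-1 * (T%:R) `^ (- (3 / 4)) ->
  0 <= lam -> lam <= (2 * eta * T%:R)^-1 ->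
  norminf x1 <= eta ->
  ((T%:R^-1)%:E *
     \sum_(1 <= t < T.+1)
        \int[P]_w (norm1 (grad (lion_x G (fun n => xi n w) b1 b2 eta lam x1 t)))%:E
   <= (C * Num.sqrt d%:R / (T%:R) `^ (1 / 4))%:E)%E.
Proof.
(* A strictly positive Lipschitz constant whatever the sign of [L], as Young's weight must be
   positive. *)
move=> cb0 ce0; pose K := `|L| + 1.
have K0 : 0 < K by rewrite ltr_wpDl.
(* In order: the initial gap, the Young remainder, the smoothness term, and the averaged momentum
   error. *)
exists (2 * Df / ce + 2 + 9 / 2 * K * ce + 2 * (2 * sigma ^+ 2
  + 2 * sigma ^+ 2 / cb + 3 * cb * sigma ^+ 2 + 9 / 2 * K ^+ 2 * ce ^+ 2 / cb ^+ 2)).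
move=> d f grad dS S mu G dO Omega P xi T b1 b2 eta lam x1 d0 df Lip mG unbiased
  variance flb fDf mxi lawxi ixi T1 b2E b2_le1 b1_ge b1_le etaE lam0 lamT x1_le.
have [P2 P3 P4] := fourth_root_powers T%:R (ler0n R T).
move: b2E etaE; rewrite P2 P3; set tau := T%:R `^ (1 / 4) in P4 *.
set sd := Num.sqrt d%:R => b2E etaE.
have T0 : 0 < T%:R :> R by rewrite ltr0n.
have tau0 : 0 < tau by exact: powR_gt0.
have tau_ge0 := ltW tau0.
have tau1 : 1 <= tau.
  by rewrite -(@expr_ge1 _ 4)// -P4 ler1n.
have sd0 : 0 < sd by rewrite sqrtr_gt0 ltr0n.
have sd2 : sd ^+ 2 = d%:R by rewrite sqr_sqrtr.
have sd_ge0 := ltW sd0.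
have eta0 : 0 < eta by rewrite etaE !mulr_gt0 ?invr_gt0 ?exprn_gt0.
have b20 : 0 < b2 by rewrite b2E mulr_gt0 ?invr_gt0 ?exprn_gt0.
have b10 : 0 <= b1 by apply: le_trans b1_ge; exact: sqr_ge0.
have b1b2 : b1 ^+ 2 <= b2.
  rewrite -[leRHS]sqr_sqrtr ?(ltW b20)//.
  by rewrite ler_pXn2r ?nnegrE ?sqrtr_ge0.
have b11 : b1 <= 1.
  by apply: le_trans b1_le _; rewrite -[leRHS]sqrtr1 ler_wsqrtr.
have lam_eta : lam * eta <= 1.
  apply: le_trans (ler_wpM2r (ltW eta0) lamT) _.
  have -> : (2 * eta * T%:R)^-1 * eta = (2 * T%:R)^-1.
    by field; rewrite !lt0r_neq0.
  have : 1 <= T%:R :> R by rewrite ler1n.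
  by move=> T1'; rewrite invf_le1; lra.
have x1i i : `|x1 ord0 i| <= eta.
  apply: le_trans x1_le; rewrite /norminf.
  exact: (le_bigmax _ (fun i => `|x1 ord0 i|)).
have LipK x y : normsq (grad x - grad y) <= K ^+ 2 * normsq (x - y).
  rewrite -!norm2_sqr -exprMn ler_pXn2r ?nnegrE ?sqrtr_ge0 ?mulr_ge0 ?sqrtr_ge0 ?(ltW K0)//.
  apply: le_trans (Lip x y) _; apply: ler_wpM2r; first exact: sqrtr_ge0.
  by apply: le_trans (ler_norm _) _; rewrite lerDl.
have f_inf x : inf (range f) <= f x by apply: ge_inf => //; exists x.
have Df0 : 0 <= Df by apply: le_trans fDf; rewrite subr_ge0.
pose X n w := (lion_state G (fun k => xi k w) b1 b2 eta lam x1 n).1.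
pose M n w := (lion_state G (fun k => xi k w) b1 b2 eta lam x1 n).2.
pose V n w := momentum n b1 (M n w) (G (X n w) (xi n.+1 w)).
have displ n w : (n < T)%N ->
    normsq (X n w - X n.+1 w) <= 9 / 4 * (eta ^+ 2 * d%:R).
  move=> nT; rewrite /X lion_iterateS opprD opprK addrA subrr add0r.
  exact: (lion_displacement G _ b1 b2 eta lam x1 eta0 lam0 lam_eta x1i T).
have descent w : eta / 2 * \sum_(k < T) norm1 (grad (X k w)) <= f x1 - f (X T w)
    + 2 * eta * (\sum_(k < T) norm1 (V k w - grad (X k w)))
    + T%:R * (9 / 4 * K * (eta ^+ 2 * d%:R)).
  exact: (lion_descent_sum G _ b1 b2 eta lam x1 eta0 lam0 lam_eta x1i T T1 lamT f
    grad K df K0 LipK).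
(* These come from multiplying the summed descent by [2 / eta] and bounding the l1 update errors by
   Young. *)
pose c0 := 2 * Df / eta + 2 * T%:R * sd / tau + T%:R * (9 / 2 * K * eta * sd ^+ 2).
pose c1 := 2 * (sd * tau).
have c00 : 0 <= c0.
  have eta_ge0 := ltW eta0; have K_ge0 := ltW K0.
  rewrite /c0; apply: addr_ge0; first apply: addr_ge0.
  - by apply: divr_ge0 => //; exact: mulr_ge0.
  - by apply: divr_ge0 => //; apply: mulr_ge0.
  - apply: mulr_ge0 => //; apply: mulr_ge0; last exact: sqr_ge0.
    by apply: mulr_ge0 => //; exact: mulr_ge0.
have c10 : 0 <= c1 by apply: mulr_ge0 => //; exact: mulr_ge0.
have path w : \sum_(n < T) norm1 (grad (X n w))
    <= c0 + c1 * \sum_(n < T) normsq (V n w - grad (X n w)).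
  (* The final value of [f] is replaced by its infimum here, so only gradient and error terms remain
     to be integrated. *)
  have := descent w; have fX := f_inf (X T w).
  set A := \sum_(k < T) norm1 _; set B := \sum_(k < T) norm1 _.
  set N := \sum_(n < T) normsq _.
  (* The weight [sd * tau] balances the two parts: the mean squared error is of order
     [(tau ^+ 2)^-1], so both contribute order [sd / tau] per step. *)
  have BN : B <= (sd * tau * N + T%:R * sd / tau) / 2.
    rewrite /B /N mulr_sumr.
    have -> : T%:R * sd / tau = \sum_(n < T) (sd / tau).
      by rewrite sumr_const card_ord -mulrA mulr_natl.
    rewrite -big_split/= mulr_suml; apply: ler_sum => n _.
    have := norm1_young (V n w - grad (X n w)) (sd * tau) (mulr_gt0 sd0 tau0).
    by rewrite -sd2 (_ : sd ^+ 2 / (sd * tau) = sd / tau)//; field; rewrite !lt0r_neq0.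
  rewrite -sd2 => H.
  rewrite -(ler_pM2l (_ : 0 < eta / 2)); last by rewrite divr_gt0.
  apply: le_trans H _.
  have -> : eta / 2 * (c0 + c1 * N) = Df + eta * (sd * tau * N + T%:R * sd / tau)
      + T%:R * (9 / 4 * K * (eta ^+ 2 * sd ^+ 2)).
    by rewrite /c0 /c1; field; rewrite !lt0r_neq0.
  have := ler_wpM2l (ltW eta0) BN; lra.
have mX n : measurable_vec (X n).
  by have [] := measurable_lion P G xi b1 b2 eta lam x1 mG mxi ixi n.
have mM n : measurable_vec (M n).
  by have [] := measurable_lion P G xi b1 b2 eta lam x1 mG mxi ixi n.
have mV n : measurable_vec (V n).
  apply: measurable_momentum => //; exact: measurable_oracle.
have mgX n : measurable_vec (fun w => grad (X n w)).
  exact: (measurable_grad mu G).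
have update n := lion_update_error mu P G grad sigma xi b1 b2 eta
  lam x1 mG unbiased variance mxi lawxi ixi K (9 / 4 * (eta ^+ 2 * d%:R)) T LipK
  displ b20 b2_le1 n.
pose r n := (1 - b2) ^+ n.-1 * (2 * sigma ^+ 2) + (2 * b2 * sigma ^+ 2
  + 2 * (K ^+ 2 * (9 / 4 * (eta ^+ 2 * d%:R))) / b2 ^+ 2) + b2 * sigma ^+ 2.
have bound : (\sum_(n < T) \int[P]_w (norm1 (grad (X n w)))%:E
    <= (c0 + c1 * \sum_(n < T) r n)%:E)%E.
  apply: (sum_integral_le P T (fun n w => norm1 (grad (X n w)))
    (fun n w => normsq (V n w - grad (X n w))) r c0 c1) => //.
  - by move=> n; exact: measurable_norm1.
  - by move=> n; apply: measurable_normsq; exact: measurable_vecB.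
  - by move=> n w; exact: norm1_ge0.
  - by move=> n w; exact: normsq_ge0.
  - by move=> n nT; exact: update.
(* The iterate $x_t$ is [X t.-1], so the sum is reindexed from 0. *)
rewrite big_add1 big_mkord.
apply: le_trans (lee_wpmul2l _ bound) _; first by rewrite lee_fin invr_ge0 ltW.
rewrite -EFinM lee_fin.
have rsum : \sum_(n < T) r n <= (1 + b2^-1) * (2 * sigma ^+ 2)
    + T%:R * (2 * b2 * sigma ^+ 2
        + 2 * (K ^+ 2 * (9 / 4 * (eta ^+ 2 * sd ^+ 2))) / b2 ^+ 2
        + b2 * sigma ^+ 2).
  rewrite /r -sd2; under eq_bigr do rewrite -addrA.
  rewrite big_split/= -mulr_suml sumr_const card_ord -[_ *+ T]mulr_natl lerD2r.
  apply: ler_wpM2r; first by apply: mulr_ge0 => //; exact: sqr_ge0.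
  exact: geometric_sum_le.
apply: le_trans (lion_rate_bound tau sd K sigma Df cb ce eta b2 tau1 sd0 cb0 ce0 K0
  etaE b2E).
rewrite -P4 ler_pM2l ?invr_gt0// lerD2l; exact: ler_wpM2l.
Qed.
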